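(* Let $A$ be a finite alphabet and let $L\subseteq A^*$ be a suffix-connected and uniformly recurrent language on $A$, with $A\subseteq L$. Then the following statements are equivalent: (1) All the return sets of $L$ generate the free group $F(A)$ on $A$. (2) Some return set of $L$ generates a group of rank $\mathrm{Card}(A)$. (3) The extension graph $\mathbf{E}(\varepsilon)$ of the empty word is connected.
   Context: $F(A)$ is the free group on $A$, $A^*$ the set of words over $A$, $\varepsilon$ the empty word, $|w|$ the length of $w$. The group generated by a return set is the subgroup of $F(A)$ it generates. A language $L\subseteq A^*$ is recurrent if it is closed under taking factors and for all $u,v\in L$ there is a non-empty word $w$ with $uwv\in L$. It is uniformly recurrent if it is recurrent and for every $u\in L$ there is $N$ such that $u$ is a factor of every word of $L$ of length at least $N$. Extension graphs: for $w\in L$ and $k,l\ge 1$, let $\mathbf{L}_k(w)=\{u\in L\cap A^k: uw\in L\}$ and $\mathbf{R}_l(w)=\{v\in L\cap A^l: wv\in L\}$. The extension graph $\mathbf{E}_{k,l}(w)$ is the simple undirected bipartite graph whose vertex set is the disjoint union of (copies of) $\mathbf{L}_k(w)$ and $\mathbf{R}_l(w)$, with an edge between $u\in\mathbf{L}_k(w)$ and $v\in\mathbf{R}_l(w)$ iff $uwv\in L$. Write $\mathbf{L}=\mathbf{L}_1$, $\mathbf{R}=\mathbf{R}_1$, $\mathbf{E}=\mathbf{E}_{1,1}$. Suffix-connectedness: $\mathrm{tail}(w)$ denotes $w$ with its first letter removed. For $w\in L$ and $1\le d\le |w|+1$, let $p$ be the prefix of $w$ of length $d-1$, so $w=p\,\mathrm{tail}^{d-1}(w)$.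 The natural embedding of $\mathbf{L}(w)$ in $\mathbf{E}_{d,d}(\mathrm{tail}^{d-1}(w))$ is the map $a\mapsto ap$ from $\mathbf{L}(w)$ to $\mathbf{L}_d(\mathrm{tail}^{d-1}(w))$. The word $w$ is suffix-connected if for some $1\le d\le|w|+1$ the image of this embedding lies in one connected component of $\mathbf{E}_{d,d}(\mathrm{tail}^{d-1}(w))$. $L$ is suffix-connected if all its non-empty words are suffix-connected. Return sets: for words $u,v$ with $uv\in L$, the return set $\mathcal{R}_{u,v}$ is the set of all $r\in L$ such that $urv\in L$, $urv$ starts and ends with $uv$, and $urv$ contains exactly two occurrences of $uv$ (an occurrence of a word is a starting position; occurrences may overlap). The return sets of $L$ are the sets $\mathcal{R}_{u,v}$ for all pairs of words $(u,v)$ with $uv\in L$.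
   Formalization: In (2) the return set is R_{u,v} with uv non-empty, since R_{ε,ε} = A always generates F(A) (so (2)⇒(3) fails for the factors of (ab)^ω); the alphabet A is assumed non-empty, since for A and L empty (1) holds and (2) fails. *)

(* Defs.v *)
From HB Require Import structures.
From mathcomp Require Import all_boot.
From mathcomp Require Import boolp classical_sets.
From Stdlib Require Import Relation_Operators.

Set Implicit Arguments.
Unset Strict Implicit.
Unset Printing Implicit Defensive.

Local Open Scope classical_set_scope.

(* The free group F(A), realized as the group of reduced words over the
   signed letters A * bool: (a, true) stands for a and (a, false) for a^-1. *)
Section FreeGroup.
Variable A : choiceType.
Implicit Types (x y : A * bool) (s t : seq (A * bool)).

Definition inv_letter x := (x.1, ~~ x.2).

Definition reduced s := sorted (fun x y => y != inv_letter x) s.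

Record freeGroup := FreeGroup { fg_word : seq (A * bool); _ : reduced fg_word }.

HB.instance Definition _ := [isSub for fg_word].
HB.instance Definition _ := [Choice of freeGroup by <:].

Definition fg_cons x s :=
  if s is y :: t then if y == inv_letter x then t else x :: s else [:: x].

(* Free reduction of s ++ t, for t reduced. *)
Definition fg_cat s t := foldr fg_cons t s.

Definition fg_rev s := rev (map inv_letter s).

Lemma inv_letterK : involutive inv_letter.
Proof. by case=> a b; rewrite /inv_letter /= negbK. Qed.

Lemma reduced_cons x s : reduced s -> reduced (fg_cons x s).
Proof.
case: s => [|y t] //= yt; case: ifP => [_|/negbT nyx]; first exact: path_sorted yt.
by rewrite /= nyx.
Qed.

Lemma reduced_cat s t : reduced t -> reduced (fg_cat s t).
Proof. by move=> rt; elim: s => //= x s IHs; apply: reduced_cons. Qed.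

Lemma reduced_rev s : reduced s -> reduced (fg_rev s).
Proof.
rewrite /reduced /fg_rev rev_sorted sorted_map.
by apply: sub_sorted => x y; rewrite /= inv_letterK eq_sym.
Qed.

Lemma fg_consK x s : reduced s -> fg_cons x (fg_cons (inv_letter x) s) = s.
Proof.
case: s => [|y t] /=; first by rewrite eqxx.
rewrite inv_letterK => yt; case: eqP => [yx|_] /=; last by rewrite eqxx.
by subst y; case: t yt => [|z t] //= /andP[/negbTE ->].
Qed.

Lemma fg_cat_cons x s t :
  reduced t -> fg_cat (fg_cons x s) t = fg_cons x (fg_cat s t).
Proof.
move=> rt; case: s => [|y s] //=; case: eqP => [->|] //.
by rewrite fg_consK //; apply: reduced_cat.
Qed.

Lemma fg_catA s t r :
  reduced r -> fg_cat s (fg_cat t r) = fg_cat (fg_cat s t) r.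
Proof. by move=> rr; elim: s => //= x s ->; rewrite fg_cat_cons. Qed.

Lemma fg_cats0 s : reduced s -> fg_cat s [::] = s.
Proof.
elim: s => //= x s IHs xs; rewrite (IHs (path_sorted xs)).
by case: s xs {IHs} => //= y s /andP[/negbTE ->].
Qed.

Lemma fg_cat_catl s t r : fg_cat (s ++ t) r = fg_cat s (fg_cat t r).
Proof. exact: foldr_cat. Qed.

Lemma fg_catV s t : reduced t -> fg_cat s (fg_cat (fg_rev s) t) = t.
Proof.
elim: s t => //= x s IHs t rt.
rewrite /fg_rev /= rev_cons -cats1 fg_cat_catl IHs /=; last exact: reduced_cons.
exact: fg_consK.
Qed.

Lemma fg_revK : involutive fg_rev.
Proof. by move=> s; rewrite /fg_rev map_rev revK mapK //; apply: inv_letterK. Qed.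

Definition fg_one : freeGroup := @FreeGroup [::] isT.

Definition fg_mul (g h : freeGroup) : freeGroup :=
  FreeGroup (reduced_cat (val g) (valP h)).

Definition fg_inv (g : freeGroup) : freeGroup := FreeGroup (reduced_rev (valP g)).

Lemma fg_mulA : associative fg_mul.
Proof. by move=> g h k; apply: val_inj; rewrite /= fg_catA //; apply: valP. Qed.

Lemma fg_mul1 : left_id fg_one fg_mul.
Proof. by move=> g; apply: val_inj. Qed.

Lemma fg_mulr1 : right_id fg_one fg_mul.
Proof. by move=> g; apply: val_inj; rewrite /= fg_cats0 //; apply: valP. Qed.

Lemma fg_mulrV : right_inverse fg_one fg_inv fg_mul.
Proof.
move=> g; apply: val_inj; rewrite /= -[X in fg_cat _ X]fg_cats0 ?fg_catV //.
exact/reduced_rev/valP.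
Qed.

Lemma fg_mulVr : left_inverse fg_one fg_inv fg_mul.
Proof.
move=> g; have -> : fg_mul (fg_inv g) g = fg_mul (fg_inv g) (fg_inv (fg_inv g)).
  by congr fg_mul; apply: val_inj; rewrite /= fg_revK.
exact: fg_mulrV.
Qed.

HB.instance Definition _ := isGroup.Build freeGroup
  fg_mulA fg_mul1 fg_mulr1 fg_mulVr fg_mulrV.

Definition fg_gen (a : A) : freeGroup := @FreeGroup [:: (a, true)] isT.

Definition fg_of_word (w : seq A) : freeGroup := (\prod_(a <- w) fg_gen a)%g.

End FreeGroup.

Section Subgroups.
Variable G : groupType.
Implicit Types H X : set G.

Definition is_subgroup H : Prop :=
  [/\ H 1%g, forall g h, H g -> H h -> H (g * h)%g & forall g, H g -> H g^-1%g].

Definition generated X : set G := smallest is_subgroup X.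

(* The rank of a group is the least cardinality of a generating set; lists may
   have repetitions, which does not affect the minimum. *)
Definition has_rank H (n : nat) : Prop :=
  (exists2 s : seq G, size s = n & generated [set` s] = H) /\
  (forall s : seq G, generated [set` s] = H -> n <= size s).

End Subgroups.

(* A simple undirected graph is given by its set of vertices V and a symmetric
   adjacency relation E that only relates vertices of V. *)
Section Graphs.
Variables (T : Type) (V : set T) (E : T -> T -> Prop).

Definition component (x : T) : set T :=
  [set y | V y /\ clos_refl_trans T E x y].

Definition graph_connected : Prop :=
  V !=set0 /\ forall x, V x -> V `<=` component x.

End Graphs.

Section Languages.
Variable A : finType.
Variable L : set (seq A).
Implicit Types u v w r : seq A.

Definition recurrent : Prop :=
  (forall u w, L w -> infix u w -> L u) /\
  (forall u v, L u -> L v -> exists2 w, w != [::] & L (u ++ w ++ v)).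

Definition uniformly_recurrent : Prop :=
  recurrent /\
  forall u, L u -> exists N : nat, forall w, L w -> N <= size w -> infix u w.

Definition left_ext (k : nat) w : set (seq A) :=
  [set u | [/\ L u, size u = k & L (u ++ w)]].

Definition right_ext (l : nat) w : set (seq A) :=
  [set v | [/\ L v, size v = l & L (w ++ v)]].

(* Vertices of the extension graph: the disjoint union of left_ext k w (tagged
   by inl) and right_ext l w (tagged by inr). *)
Definition ext_vertices (k l : nat) w : set (seq A + seq A) :=
  [set x | match x with inl u => left_ext k w u | inr v => right_ext l w v end].

Definition ext_adj (k l : nat) w (x y : seq A + seq A) : Prop :=
  match x, y with
  | inl u, inr v | inr v, inl u =>
      [/\ left_ext k w u, right_ext l w v & L (u ++ w ++ v)]
  | _, _ => False
  end.

Definition ext_connected (k l : nat) w : Prop :=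
  graph_connected (ext_vertices k l w) (ext_adj k l w).

(* With p the prefix of w of length d - 1, the natural embedding maps the
   one-letter left extension a of w to the left extension a p of
   tail^(d-1) w; u below is the one-letter word a. *)
Definition suffix_connected_word w : Prop :=
  exists2 d : nat, 1 <= d <= (size w).+1 &
    let p := take d.-1 w in
    let t := iter d.-1 behead w in
    exists2 x, ext_vertices d d t x &
      [set inl (u ++ p) | u in left_ext 1 w] `<=`
        component (ext_vertices d d t) (ext_adj d d t) x.

Definition suffix_connected : Prop :=
  forall w, L w -> w != [::] -> suffix_connected_word w.

(* The empty word occurs at each of the (size w).+1 positions of w. *)
Definition occurrences u w : nat :=
  count (fun i => prefix u (drop i w)) (iota 0 (size w).+1).

Definition return_set u v : set (seq A) :=
  [set r | [/\ L r, L (u ++ r ++ v), prefix (u ++ v) (u ++ r ++ v),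
               suffix (u ++ v) (u ++ r ++ v) &
               occurrences (u ++ v) (u ++ r ++ v) = 2]].

Definition return_group u v : set (freeGroup A) :=
  generated [set fg_of_word r | r in return_set u v].

End Languages.

(* Main.v *)
Require Import Defs.
From mathcomp Require Import all_boot.
From mathcomp Require Import boolp classical_sets.
From mathcomp Require Import zify.
From Stdlib Require Import Relation_Operators.

(** The return groups of [L] are compared with the groups of loops of its Rauzy
    graphs. Label the edges of the Rauzy graph of order [m] by their last letters
    and let a walk, in which edges may be followed backwards, be labelled by the
    corresponding element of the free group; write [Loops x] for the group of
    labels of the closed walks at the vertex [x]. Deleting first letters maps
    walks of order [m.+1] to walks of order [m] with the same label, so
    [Loops (a :: x)] is contained in [Loops x]. The converse inclusion holds as
    soon as all vertices [a :: y], [b :: y] above a common [y] of length [m] are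
    joined by walks with trivial label ([rauzy_walk_lift]). Suffix-connectedness
    of [y] gives precisely this: a path in an extension graph of a suffix of [y]
    turns into a walk of order [m.+1] in which the labels cancel two by two
    ([suffix_connected_joined]).

    The group generated by the returns to a word [w], each read after an
    occurrence of [w], is contained in [Loops w]. By uniform recurrence there is
    a vertex [z ++ w] of an order so large that all vertices contain [w]; cutting
    the walks at occurrences of [w] then shows that [Loops (z ++ w)] is contained
    in the return group ([long_loop_return_group]). If all words of [L] at least
    as long as a suffix [x] of [w] are suffix-connected, these inclusions are
    equalities and the return group is [Loops x] ([return_group_loops]); for a
    return set [return_set L u v] with [u ++ v = w] this is so up to conjugation
    by [v].

    If the extension graph of the empty word is connected, the empty word is
    suffix-connected too, so one can take [x = [::]]: the Rauzy graph of order 0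
    has one vertex and a loop for each letter, and its group of loops is the
    whole free group, of rank [#|A|]. If the extension graph is disconnected, the
    return group of a nonempty word ending with [a] is conjugate to
    [Loops [:: a]]. In the Rauzy graph of order 1, letters in one component of
    the extension graph are joined by walks with trivial label, so that
    [Loops [:: a]] is the group of loops of a connected graph with at least two
    vertices, the components, and one edge per letter. Contracting one edge
    between two distinct components leaves at most [#|A| - 1] generators
    ([disconnected_loops_generated]), which is too few for rank [#|A|]. *)

Set Implicit Arguments.
Unset Strict Implicit.
Unset Printing Implicit Defensive.

Local Open Scope classical_set_scope.
Local Open Scope group_scope.

(** * Subgroups *)

Section Subgroups.
Variable G : groupType.
Implicit Types H X : set G.

Lemma generated_is_subgroup X : is_subgroup (generated X).
Proof.
split=> [|g h gX hX|g gX] H [HH XH]; have [H1 HM HV] := HH => //.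
- by apply: HM; [exact: (gX H)|exact: (hX H)].
- by apply: HV; exact: (gX H).
Qed.

Lemma subset_generated X : X `<=` generated X.
Proof. exact: sub_gen_smallest. Qed.

Lemma generated_min X H : is_subgroup H -> X `<=` H -> generated X `<=` H.
Proof. exact: smallest_sub. Qed.

Lemma is_subgroup_conj H x : is_subgroup H -> is_subgroup [set g | H (g ^ x)].
Proof.
case=> H1 HM HV; split=> /= [|g h Hg Hh|g Hg]; first by rewrite conj1g.
- by rewrite conjMg; apply: HM.
- by rewrite conjVg; apply: HV.
Qed.

Lemma generated_map_conj (s : seq G) x :
  generated [set` [seq g ^ x^-1 | g <- s]] = [set g | generated [set` s] (g ^ x)].
Proof.
apply/seteqP; split=> g /=.
  apply: (generated_min (is_subgroup_conj _ (generated_is_subgroup _))).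
  by move=> _ /mapP[h hs ->] /=; rewrite conjgKV; apply: subset_generated.
move=> sg; rewrite -(conjgK x g); move: sg.
apply: (generated_min (is_subgroup_conj _ (generated_is_subgroup _))).
by move=> h hs; apply: subset_generated; apply/mapP; exists h.
Qed.

End Subgroups.

(** * Walks in a graph with edges labelled by group elements *)

Section Walks.
Variables (V : Type) (G : groupType) (edge : V -> G -> V -> Prop).
Implicit Types (x y z : V) (g h : G).

Inductive walk x : V -> G -> Prop :=
| walk_nil : walk x x 1
| walk_forth y z g h : walk x y g -> edge y h z -> walk x z (g * h)
| walk_back y z g h : walk x y g -> edge z h y -> walk x z (g * h^-1).

Lemma walk_edge x y g : edge x g y -> walk x y g.
Proof. by move=> e; rewrite -[g]mul1g; apply: walk_forth e; apply: walk_nil. Qed.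

Lemma walk_cat x y z g h : walk x y g -> walk y z h -> walk x z (g * h).
Proof.
move=> xy; elim=> [|t u k l _ IH e|t u k l _ IH e]; first by rewrite mulg1.
- by rewrite mulgA; apply: walk_forth e.
- by rewrite mulgA; apply: walk_back e.
Qed.

Lemma walk_rev x y g : walk x y g -> walk y x g^-1.
Proof.
elim=> [|t u k l _ IH e|t u k l _ IH e]; first by rewrite invg1; apply: walk_nil.
- rewrite invgM; apply: walk_cat IH; rewrite -[l^-1]mul1g.
  by apply: walk_back e; apply: walk_nil.
- by rewrite invgM invgK; apply: walk_cat IH; apply: walk_edge.
Qed.

Lemma walk_is_subgroup x : is_subgroup [set g | walk x x g].
Proof.
by split=> /= [|g h|g]; [apply: walk_nil|apply: walk_cat|apply: walk_rev].
Qed.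

(** A telescoping argument: in the product of the elements
    [th y * h * (th z)^-1] along a walk, the inner values of [th] cancel. *)
Lemma walk_telescope (H : set G) (th : V -> G) :
    is_subgroup H ->
    (forall y h z, edge y h z -> H (th y * h * (th z)^-1)) ->
  forall x y g, walk x y g -> H (th x * g * (th y)^-1).
Proof.
case=> H1 HM HV He x y g; elim=> [|t u k l _ IH e|t u k l _ IH e].
- by rewrite mulg1 mulgV.
- have /(HM _ _ IH) := He _ _ _ e.
  by rewrite !mulgA mulgVK -!mulgA.
- have /HV/(HM _ _ IH) := He _ _ _ e.
  by rewrite !invgM invgK !mulgA mulgVK -!mulgA.
Qed.

End Walks.

(** * Free groups *)

Section FreeGroups.
Variable A : choiceType.
Local Notation F := (freeGroup A).

Lemma fg_of_word0 : fg_of_word [::] = 1 :> F.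
Proof. exact: big_nil. Qed.

Lemma fg_of_word1 (a : A) : fg_of_word [:: a] = fg_gen a.
Proof. exact: big_seq1. Qed.

Lemma fg_of_word_cat (s t : seq A) :
  fg_of_word (s ++ t) = fg_of_word s * fg_of_word t.
Proof. exact: big_cat. Qed.

Lemma fg_of_word_rcons (s : seq A) a :
  fg_of_word (rcons s a) = fg_of_word s * fg_gen a.
Proof. by rewrite -cats1 fg_of_word_cat fg_of_word1. Qed.

Lemma gen_subgroup_full (H : set F) :
  is_subgroup H -> (forall a, H (fg_gen a)) -> forall g, H g.
Proof.
case=> H1 HM HV Hgen [s]; elim: s => [|[a b] s IHs] rs.
  by have -> : FreeGroup rs = 1 by apply: val_inj.
have rs' : reduced s := path_sorted rs.
have Hx : H (FreeGroup (isT : reduced [:: (a, b)])).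
  have Ha : FreeGroup (isT : reduced [:: (a, true)]) = fg_gen a by apply: val_inj.
  case: b {rs} => //; first by rewrite Ha.
  have -> : FreeGroup (isT : reduced [:: (a, false)]) = (fg_gen a)^-1.
    exact: val_inj.
  exact: HV.
have -> : FreeGroup rs = FreeGroup (isT : reduced [:: (a, b)]) * FreeGroup rs'.
  apply: val_inj; rewrite /= /fg_cons.
  by case: s rs {IHs rs'} => //= y s /andP[/negbTE ->].
exact: HM.
Qed.

(** The value at [g] of the morphism to the group of two elements that sends
    the letter [a] to [f a]. *)
Definition parity (f : A -> bool) (g : F) : bool :=
  odd (count (fun x => f x.1) (val g)).

Lemma parityM f g h : parity f (g * h) = parity f g (+) parity f h.
Proof.
rewrite /parity; case: g h => [s _] [t _] /=.
elim: s => [|x s IHs] //=.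
rewrite oddD -addbA -IHs; case: (fg_cat s t) => [|y r] /=.
  by rewrite addn0 oddb addbF.
case: eqP => [->|_] /=; last by rewrite oddD.
by rewrite oddD addKb.
Qed.

Lemma parity_gen f a : parity f (fg_gen a) = f a.
Proof. by rewrite /parity /= addn0 oddb. Qed.

End FreeGroups.

(** The [2 ^ #|A|] morphisms to the group of two elements are told apart by
    their values on a generating list. *)
Lemma generated_size (A : finType) (s : seq (freeGroup A)) :
  generated [set` s] = setT -> #|A| <= size s.
Proof.
move=> sT; rewrite -(@leq_exp2l 2) // -card_bool -card_ffun.
pose r (f : {ffun A -> bool}) := map_tuple (parity f) (in_tuple s).
have rI : injective r.
  move=> f f' /(congr1 val) /= /eq_in_map ff'.
  have Hff' : generated [set` s] `<=` [set g | parity f g = parity f' g].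
    apply: generated_min => [|g /= /ff' //]; split=> /= [//|g h eg eh|g eg].
      by rewrite !parityM eg eh.
    have := parityM f g g^-1; have := parityM f' g g^-1.
    by rewrite mulgV eg /parity /= => -> /addbI.
  apply/ffunP => a; rewrite -(parity_gen f) -(parity_gen f').
  by apply: Hff'; rewrite sT.
by rewrite -(card_tuple (size s)); apply: leq_card rI.
Qed.

Lemma freeGroup_rank (A : finType) : has_rank [set: freeGroup A] #|A|.
Proof.
split; last exact: generated_size.
exists (map (@fg_gen A) (enum A)); first by rewrite size_map -cardE.
apply/seteqP; split=> // g _.
apply: gen_subgroup_full; first exact: generated_is_subgroup.
by move=> a; apply: subset_generated => /=; rewrite map_f ?mem_enum.
Qed.

(** * Rauzy graphs *)

Section Rauzy.
Variables (A : finType) (L : set (seq A)).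
Hypothesis Lrec : recurrent L.
Implicit Types (a b c : A) (u v w x y z r s : seq A) (g h : freeGroup A).

Lemma factor_closed u w : L w -> infix u w -> L u.
Proof. by case: Lrec => Lf _; apply: Lf. Qed.

Lemma left_extendable x : L x -> exists a, L (a :: x).
Proof.
move=> Lx; have [w] := Lrec.2 _ _ Lx Lx.
case/lastP: w => // w a _ Lw; exists a; apply: factor_closed Lw _.
by rewrite catA suffixW // -cats1 catA -catA suffix_suffix.
Qed.

Lemma left_extendable_by k x : L x -> exists2 z, size z = k & L (z ++ x).
Proof.
move=> Lx; elim: k => [|k [z sz Lz]]; first by exists [::].
by have [a La] := left_extendable Lz; exists (a :: z); rewrite /= ?sz.
Qed.

(** The Rauzy graph of order [m]: its vertices are the words of length [m], and
    each word [rcons x c] of length [m.+1] is an edge from its prefix to its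
    suffix of length [m]. Labelling it by its last letter makes deletion of the
    first letter a label-preserving map from order [m.+1] to order [m]. *)
Definition rauzy_edge (m : nat) x g y : Prop :=
  exists c, [/\ size x = m, L (rcons x c), y = behead (rcons x c) & g = fg_gen c].

Notation rauzy_walk m := (walk (rauzy_edge m)).

Lemma rauzy_walk_word x r : L (x ++ r) ->
  rauzy_walk (size x) x (drop (size r) (x ++ r)) (fg_of_word r).
Proof.
elim/last_ind: r => [|r c IHr] Lxr.
  by rewrite drop0 cats0 fg_of_word0; apply: walk_nil.
have Lr : L (x ++ r).
  by apply: factor_closed Lxr _; rewrite -rcons_cat infix_rcons.
rewrite fg_of_word_rcons; apply: walk_forth (IHr Lr) _.
have sr : size r <= size (x ++ r) by rewrite size_cat leq_addl.
exists c; split => //.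
- by rewrite size_drop size_cat addnK.
- rewrite -drop_rcons // rcons_cat.
  by apply: factor_closed Lxr _; apply: infix_drop.
- by rewrite size_rcons -rcons_cat -drop_rcons // -drop1 drop_drop add1n.
Qed.

(** * Lifting walks to higher order *)

(** All the vertices of order [(size w).+1] above the vertex [w] are joined by
    walks with trivial label. This is what suffix-connectedness of [w] gives,
    and what allows walks through [w] to be lifted. *)
Definition trivially_joined w : Prop := forall a b,
  L (a :: w) -> L (b :: w) -> rauzy_walk (size w).+1 (a :: w) (b :: w) 1.

(** An edge between [u] and [v] in the extension graph of [t] is the word
    [u ++ t ++ v]; it gives a walk labelled [v] from [u ++ t] to [t ++ v]. So
    in a path of the extension graph each right vertex is entered and left by
    walks with inverse labels, and the labels of a path between left vertices
    cancel out. *)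
Lemma suffix_connected_joined w :
  suffix_connected_word L w -> trivially_joined w.
Proof.
case=> d dw; set p := take _ _; set t := iter _ _ _ => /= -[x _ Hx] a b La Lb.
have wE : p ++ t = w.
  rewrite /p /t; have -> : iter d.-1 behead w = drop d.-1 w.
    elim: {dw p t Hx} d.-1 => [|k IHk] /=; first by rewrite drop0.
    by rewrite IHk -drop1 drop_drop.
  exact: cat_take_drop.
have sp : size p = d.-1 by rewrite size_takel //; case/andP: dw; case: (d).
have st : d + size t = (size w).+1.
  by rewrite -wE size_cat sp -addSn prednK //; case/andP: dw.
pose vertex e := match e with inl u => u ++ t | inr v => t ++ v end.
pose label (e : seq A + seq A) : freeGroup A :=
  match e with inl _ => 1 | inr v => fg_of_word v end.
have Hstep u v : ext_adj L d d t (inl u) (inr v) ->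
    rauzy_walk (size w).+1 (u ++ t) (t ++ v) (fg_of_word v).
  case=> -[_ su _] [_ sv _]; rewrite catA => /rauzy_walk_word.
  by rewrite size_cat su st -catA drop_size_cat ?su ?sv.
have Hwalk e f : clos_refl_trans _ (ext_adj L d d t) e f ->
    rauzy_walk (size w).+1 (vertex e) (vertex f) ((label e)^-1 * label f).
  elim=> {e f} [e f|e|e f k _ IH _ IH'].
  - case: e f => [u|v] [u'|v'] //= Hadj; last first.
      by rewrite mulg1; apply: walk_rev; apply: Hstep.
    by rewrite invg1 mul1g; apply: Hstep.
  - by rewrite mulVg; apply: walk_nil.
  - by have := walk_cat IH IH'; rewrite mulgA mulgK.
have Hleft c : L (c :: w) ->
    rauzy_walk (size w).+1 (vertex x) (c :: w) (label x)^-1.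
  move=> Lc; have [|_ /Hwalk] := Hx (inl (c :: p)).
    exists [:: c] => //; split=> //; apply: factor_closed Lc _.
    exact: (prefix_infix [:: c]).
  by rewrite /= wE mulg1.
by have := walk_cat (walk_rev (Hleft a La)) (Hleft b Lb); rewrite invgK mulgV.
Qed.

Lemma behead_rcons_cons x c :
  exists d, rcons x c = d :: behead (rcons x c).
Proof. by case: x => [|d x] /=; [exists c|exists d]. Qed.

(** Each edge of the walk lifts, once some letter is put in front of it; the
    lifts of consecutive edges need not meet, but there is a walk with trivial
    label from the end of one to the start of the next. *)
Lemma rauzy_walk_lift m x y g a b :
    (forall w, L w -> size w = m -> trivially_joined w) ->
    size x = m -> rauzy_walk m x y g -> L (a :: x) -> L (b :: y) ->
  rauzy_walk m.+1 (a :: x) (b :: y) g.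
Proof.
move=> Hj sx xy La; have tail_in c w : L (c :: w) -> L w.
  by move=> /factor_closed; apply; apply: infix_cons.
have join w c d : size w = m -> L (c :: w) -> L (d :: w) ->
    rauzy_walk m.+1 (c :: w) (d :: w) 1.
  move=> sw Lc; have := Hj w (tail_in _ _ Lc) sw.
  by rewrite /trivially_joined sw; apply.
elim: xy b => [|y' z k h _ IH e|y' z k h _ IH e] b Lb; first exact: join.
- case: e => c [sy Ly zE ->]; have [d dE] := behead_rcons_cons y' c.
  have sz : size z = m by rewrite zE size_behead size_rcons.
  have [a' La'] := left_extendable Ly.
  have Lay : L (a' :: y').
    by apply: factor_closed La' _; rewrite -rcons_cons infix_rcons.
  have Ldz : L (d :: z) by rewrite zE -dE.
  rewrite -[k * _]mulg1; apply: walk_cat (join _ _ _ sz Ldz Lb).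
  apply: walk_forth (IH _ Lay) _; exists c.
  by split; rewrite //= ?sy // zE -dE.
- case: e => c [sz Lz yE ->]; have [d dE] := behead_rcons_cons z c.
  have [a' La'] := left_extendable Lz.
  have Laz : L (a' :: z).
    by apply: factor_closed La' _; rewrite -rcons_cons infix_rcons.
  have Ldy : L (d :: y') by rewrite yE -dE.
  rewrite -[k * _]mulg1; apply: walk_cat (join _ _ _ sz Laz Lb).
  apply: walk_back (IH _ Ldy) _; exists c.
  by split; rewrite //= ?sz // yE -dE.
Qed.

Lemma rauzy_loop_lift x z g :
    (forall w, L w -> size x <= size w -> trivially_joined w) ->
    L (z ++ x) -> rauzy_walk (size x) x x g ->
  rauzy_walk (size (z ++ x)) (z ++ x) (z ++ x) g.
Proof.
move=> Hj + xx; elim: z => [|a z IHz] //= Laz.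
have Lz : L (z ++ x) by apply: factor_closed Laz _; apply: infix_cons.
apply: rauzy_walk_lift => //; last exact: IHz.
by move=> w Lw sw; apply: Hj; rewrite // sw size_cat leq_addl.
Qed.

(** * Return groups as groups of loops *)

(** A word [r] that leads from an occurrence of [u ++ v] to a later one is the
    product of the words that lead from each occurrence to the next. The
    conjugation accounts for the factors [r] being read after [u ++ v], while
    those in [return_set L u v] are read after [u]. *)
Lemma return_group_complete u v r :
    L ((u ++ v) ++ r) -> suffix (u ++ v) ((u ++ v) ++ r) ->
  return_group L u v (fg_of_word r ^ (fg_of_word v)^-1).
Proof.
have [RG1 RGM _] :=
  generated_is_subgroup [set fg_of_word r | r in return_set L u v].
set w := u ++ v.
elim: {r}(size r).+1 {-2}r (ltnSn (size r)) => // n IHn r rn Lr sr.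
have [->|r0] := eqVneq r [::]; first by rewrite fg_of_word0 conj1g.
pose P i := prefix w (drop i (w ++ r)).
have P0 : P 0 by rewrite /P drop0 prefix_prefix.
have Pr : P (size r).
  rewrite /P; move: sr; rewrite suffixE size_cat addnC addnK => /eqP ->.
  by rewrite prefix_refl.
have r_gt0 : 0 < size r by rewrite lt0n size_eq0.
(* Cut [r] at an intermediate occurrence of [w], if there is one; otherwise the
   only occurrences of [w] in [w ++ r] are at [0] and [size r], and [r] is
   conjugate to an element of the return set. *)
have [/hasP[/= i]|/hasPn noP] := boolP (has P (iota 1 (size r).-1)).
  rewrite mem_iota add1n prednK // => /andP[i0 ir] /prefixP[y yE].
  have wrE : w ++ r = take i (w ++ r) ++ w ++ y by rewrite -yE cat_take_drop.
  have sti : size (take i (w ++ r)) = i by rewrite size_takel // size_cat; lia.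
  have rE : r = take i r ++ y.
    rewrite -{1}(cat_take_drop i r); congr (_ ++ _).
    have : drop (size w) (drop i (w ++ r)) = y by rewrite yE drop_size_cat.
    by rewrite drop_drop addnC -drop_drop drop_size_cat.
  have wtE : w ++ take i r = take i (w ++ r) ++ w.
    move: wrE; rewrite {1}rE (catA w) (catA (take i _)) => /eqP.
    rewrite eqseq_cat; first by case/andP=> /eqP.
    by rewrite !size_cat sti size_takel ?(ltnW ir) // addnC.
  have sy : suffix w (w ++ y).
    move: sr; rewrite !suffixE => /eqP sr; apply/eqP.
    rewrite -[RHS]sr -yE drop_drop.
    by rewrite size_drop (size_cat w r) subnAC addKn subnK 1?ltnW.
  rewrite rE fg_of_word_cat conjMg; apply: RGM; apply: IHn.
  - by rewrite size_takel; lia.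
  - by apply: factor_closed Lr _; rewrite wrE catA -wtE prefix_infix.
  - by rewrite wtE suffix_suffix.
  - by move: (congr1 size rE) rn; rewrite size_cat size_takel; lia.
  - by apply: factor_closed Lr _; rewrite wrE suffix_infix.
  - exact: sy.
have /suffixP[r' r'E] : suffix v (v ++ r).
  have : suffix v ((u ++ v) ++ r) by apply: suffix_trans sr; apply: suffix_suffix.
  rewrite !suffixE -catA size_cat -addnBA ?size_cat ?leq_addr //.
  by rewrite addnC -drop_drop drop_size_cat.
have wrE : w ++ r = u ++ r' ++ v by rewrite /w -catA r'E.
have -> : fg_of_word r ^ (fg_of_word v)^-1 = fg_of_word r'.
  move: (congr1 (@fg_of_word A) r'E); rewrite !fg_of_word_cat => vr.
  by rewrite conjgE invgK mulgA vr mulgK.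
apply: subset_generated; exists r' => //; rewrite /return_set /= -wrE; split=> //.
- by apply: factor_closed Lr _; rewrite wrE infix_infix.
- exact: prefix_prefix.
rewrite /occurrences -/w size_cat addnC.
have -> : (size r + size w).+1 = 1 + ((size r).-1 + (1 + size w)) by lia.
rewrite !iotaD !count_cat -/P /=.
rewrite P0 !add0n !add1n addn1 prednK // Pr.
have count0 t : {in t, forall i, ~~ P i} -> count P t = 0.
  by move/hasPn; rewrite has_count -leqNgt leqn0 => /eqP.
rewrite !count0 // => i; rewrite mem_iota => /andP[ri iw].
apply/negP => /size_prefix; rewrite size_drop (size_cat w r).
by move: ri iw => /=; move: (size w) => k; lia.
Qed.

Lemma return_group_two_suffixes u v s t X : L X ->
    suffix ((u ++ v) ++ s) X -> suffix ((u ++ v) ++ t) X ->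
  return_group L u v ((fg_of_word s / fg_of_word t) ^ (fg_of_word v)^-1).
Proof.
have [_ _ RGV] :=
  generated_is_subgroup [set fg_of_word r | r in return_set L u v].
set w := u ++ v; move=> LX.
(* Exchanging [s] and [t] inverts the element. *)
wlog st : s t / size t <= size s => [IH sX tX|].
  have [|/ltnW] := leqP (size t) (size s) => st; first exact: IH.
  by rewrite -invgF conjVg; apply: RGV; apply: IH.
move=> sX tX.
have /suffixP[p pE] : suffix (w ++ t) (w ++ s).
  move: sX tX => /suffixP[q ->]; rewrite !suffixE size_cat.
  rewrite -addnBA; last by rewrite !size_cat leq_add2l.
  by rewrite addnC -drop_drop drop_size_cat.
have /suffixP[r rE] : suffix t s.
  have : suffix t (w ++ s) by rewrite pE catA suffix_suffix.
  rewrite !suffixE size_cat -addnBA //.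
  by rewrite addnC -drop_drop drop_size_cat.
have wrE : w ++ r = p ++ w.
  move: pE; rewrite rE !(catA _ _ t) => E.
  move/eqP: (E); rewrite eqseq_cat; first by case/andP=> /eqP.
  by move/(congr1 size): E; rewrite !(size_cat _ t) => /addIn.
rewrite rE fg_of_word_cat mulgK; apply: return_group_complete.
  rewrite -/w; apply: factor_closed LX _; apply: infix_trans (suffixW sX).
  by rewrite rE catA prefix_infix.
by rewrite -/w wrE suffix_suffix.
Qed.

(** When the vertices are long enough to contain [w = u ++ v], let [th x] be
    what follows an occurrence of [w] in [x]. For an edge from [x] to [y]
    labelled [c], the words [th x * c] and [th y] both follow an occurrence of
    [w] and end at the same place in one word of [L], so they differ by an
    element of the return group. *)
Lemma long_loop_return_group u v W g :
    (forall x, L x -> size x = size W -> infix (u ++ v) x) ->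
    L W -> suffix (u ++ v) W -> rauzy_walk (size W) W W g ->
  return_group L u v (g ^ (fg_of_word v)^-1).
Proof.
set w := u ++ v => Hw LW wW WW.
pose tl x := drop (size w) (drop (infix_index w x) x).
have tlP x : L x -> size x = size W -> suffix (w ++ tl x) x.
  move=> Lx sx; have := Hw x Lx sx; rewrite infixE => /eqP wE.
  by rewrite -{1}wE cat_take_drop suffix_drop.
pose H := [set h | return_group L u v (h ^ (fg_of_word v)^-1)].
have HH : is_subgroup H by apply/is_subgroup_conj/generated_is_subgroup.
have [_ HM HV] := HH.
have H_W : H (fg_of_word (tl W)).
  rewrite -[X in H X]divg1 -fg_of_word0.
  by apply: return_group_two_suffixes LW (tlP W LW _) _; rewrite ?cats0.
have H_g : H (fg_of_word (tl W) * g * (fg_of_word (tl W))^-1).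
  have := walk_telescope (th := fun x => fg_of_word (tl x)) HH _ WW; apply.
  move=> x h y [c [sx LX yE ->]].
  have sy : size y = size W by rewrite yE size_behead size_rcons.
  have yX : suffix y (rcons x c) by rewrite yE -drop1 suffix_drop.
  have Lx : L x by apply: factor_closed LX _; apply: infix_rcons.
  have Ly : L y by apply: factor_closed LX _; apply: suffixW.
  rewrite -fg_of_word_rcons; apply: return_group_two_suffixes LX _ _.
    by rewrite -rcons_cat suffix_rcons eqxx tlP.
  by apply: suffix_trans yX; apply: tlP.
by have := HM _ _ (HV _ H_W) (HM _ _ H_g H_W); rewrite mulgVK mulKg.
Qed.

(** The return group is contained in the group of the loops of each order, and
    it contains that of the loops of large order; once the walks lift, the
    groups of loops of all orders coincide. *)
Lemma return_group_loops u v x g :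
    (forall w, L w -> exists N, forall y, L y -> N <= size y -> infix w y) ->
    (forall w, L w -> size x <= size w -> trivially_joined w) ->
    L (u ++ v) -> suffix x (u ++ v) ->
  return_group L u v g <-> rauzy_walk (size x) x x (g ^ fg_of_word v).
Proof.
move=> Hunif Hj Luv /suffixP[y yE]; split.
  apply: (generated_min (is_subgroup_conj _ (walk_is_subgroup _ _))).
  move=> _ [r [_ Lurv /prefixP[r' r'E] sr _] <-] /=.
  have vrE : r ++ v = v ++ r'.
    by move/eqP: r'E; rewrite -catA eqseq_cat // eqxx => /eqP.
  have -> : fg_of_word r ^ fg_of_word v = fg_of_word r'.
    rewrite conjgE; move/(congr1 (@fg_of_word A)): vrE.
    by rewrite !fg_of_word_cat => ->; rewrite mulKg.
  have Lxr : L (x ++ r').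
    by apply: factor_closed Lurv _; rewrite r'E yE -catA suffix_infix.
  suff xE : drop (size r') (x ++ r') = x.
    by have := rauzy_walk_word Lxr; rewrite xE.
  have : suffix x (x ++ r').
    have : suffix x (y ++ (x ++ r')).
      by rewrite catA -yE -r'E; apply: suffix_trans sr; rewrite yE suffix_suffix.
    rewrite !suffixE size_cat -addnBA; last by rewrite size_cat leq_addr.
    by rewrite addnC -drop_drop drop_size_cat.
  by rewrite suffixE size_cat addKn => /eqP.
move=> xx; have [N HN] := Hunif _ Luv.
have [z sz Lz] := left_extendable_by N Luv.
rewrite -[g](conjgK (fg_of_word v)).
apply: (@long_loop_return_group _ _ (z ++ u ++ v)) => //.
- move=> w Lw sw; apply: HN => //; rewrite sw size_cat sz; exact: leq_addr.
- exact: suffix_suffix.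
- by move: Lz; rewrite yE catA => Lz; apply: rauzy_loop_lift.
Qed.

(** * The extension graph of the empty word and the loops of order one *)

(** Adjacency of letters through a common right neighbour; the classes of its
    reflexive transitive closure are the traces, on the left vertices, of the
    connected components of the extension graph of the empty word. *)
Definition share_right : rel A :=
  fun a b => `[< exists c, L [:: a; c] /\ L [:: b; c] >].

Lemma share_right_intro a b c : L [:: a; c] -> L [:: b; c] -> share_right a b.
Proof. by move=> Lac Lbc; apply/asboolP; exists c. Qed.

Lemma connect_share_sym : connect_sym share_right.
Proof.
apply: sym_connect_sym => a b; apply/asboolP/asboolP => -[c [La Lb]];
by exists c.
Qed.

Lemma rauzy_walk_connect a b :
  connect share_right a b -> rauzy_walk 1 [:: a] [:: b] 1.
Proof.
case/connectP => p; elim: p a => [a _ ->|c p IHp a]; first exact: walk_nil.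
case/andP=> /asboolP[d [Lad Lcd]] cp bE.
rewrite -[1]mul1g; apply: walk_cat (IHp c cp bE).
have e (x : A) : L [:: x; d] -> rauzy_edge 1 [:: x] (fg_gen d) [:: d].
  by move=> Lxd; exists d.
rewrite -(mulgV (fg_gen d)); apply: walk_back (e c Lcd).
exact: walk_edge (e a Lad).
Qed.

Lemma connected_suffix_connected :
  ext_connected L 1 1 [::] -> suffix_connected_word L [::].
Proof.
case=> -[e Ve] Hconn; exists 1%N => //=; exists e => // _ [u [Lu su Lu0] <-].
by apply: Hconn Ve _ _; rewrite cats0.
Qed.

Section Letters.
Hypothesis letters : forall a, L [:: a].

Lemma connect_share_ext_connected : 0 < #|A| ->
  (forall a b, connect share_right a b) -> ext_connected L 1 1 [::].
Proof.
move=> /card_gt0P[a0 _] Hconn.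
pose adj := ext_adj L 1 1 [::].
have Lv a : left_ext L 1 [::] [:: a] by split=> //; apply: letters.
have Rv a : right_ext L 1 [::] [:: a] by split=> //; apply: letters.
have path_lr a b : L [:: a; b] -> clos_refl_trans _ adj (inl [:: a]) (inr [:: b]).
  by move=> Lab; apply: rt_step; split; rewrite /= ?cats0.
have path_rl a b : L [:: a; b] -> clos_refl_trans _ adj (inr [:: b]) (inl [:: a]).
  by move=> Lab; apply: rt_step; split; rewrite /= ?cats0.
have path_ll a b : clos_refl_trans _ adj (inl [:: a]) (inl [:: b]).
  case/connectP: (Hconn a b) => p; elim: p a => [a _ ->|c p IHp a].
    exact: rt_refl.
  case/andP=> /asboolP[d [Lad Lcd]] cp bE; apply: rt_trans (IHp c cp bE).
  by apply: rt_trans (path_lr _ _ Lad) (path_rl _ _ Lcd).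
have one u : size u = 1%N -> exists a, u = [:: a].
  by case: u => [|a []] // _; exists a.
have to_left (x : seq A + seq A) : ext_vertices L 1 1 [::] x ->
    exists a, clos_refl_trans _ adj x (inl [:: a]) /\
              clos_refl_trans _ adj (inl [:: a]) x.
  case: x => w [_ /one[a ->] _]; first by exists a; split; apply: rt_refl.
  by have [b Lb] := left_extendable (letters a); exists b; split; auto.
split; first by exists (inl [:: a0]); apply: Lv.
move=> x /to_left[a [xa _]] y Vy; split=> //.
have [b [_ b_y]] := to_left _ Vy.
by apply: rt_trans xa (rt_trans _ _ _ _ _ (path_ll a b) b_y).
Qed.

Lemma edges_connect_share :
    (forall a b, L [:: a; b] -> connect share_right a b) ->
  forall a b, connect share_right a b.
Proof.
move=> Hedge.
have Hword w : forall a, L (a :: w) -> connect share_right a (last a w).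
  elim: w => [|c w IHw] a Law /=; first exact: connect0.
  apply: connect_trans (IHw c _); last first.
    by apply: factor_closed Law _; apply: infix_cons.
  by apply: Hedge; apply: factor_closed Law _; apply: (prefix_infix [:: a; c]).
move=> a b; have [w _ Lw] := Lrec.2 _ _ (letters a) (letters b).
by have := Hword _ _ Lw; rewrite last_cat.
Qed.

(** Collapse each class of letters to a point: every letter [b] becomes an edge
    from the class of its left neighbours to its own class. Any choice of walks
    [th x] from [a] to each class yields one generator
    [th (pred b) * b * (th b)^-1] of the group of loops per letter [b]. If the
    edge [b0] joins two distinct classes, then the walk to the class of [b0]
    can be chosen to end with this edge, which makes its generator trivial. *)
Lemma disconnected_loops_generated a :
    (exists b c, ~~ connect share_right b c) ->
  exists2 s : seq (freeGroup A), size s < #|A| &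
    generated [set` s] = [set g | rauzy_walk 1 [:: a] [:: a] g].
Proof.
case=> b1 [c1 b1c1].
have [p [b0 [Lpb pb]]] :
    exists p b0, L [:: p; b0] /\ ~~ connect share_right p b0.
  apply: contrapT => H; case/negP: b1c1; apply: edges_connect_share => x y Lxy.
  by apply: contrapT => /negP xy; apply: H; exists x, y.
have /choice[pred predP] : forall b, exists c, L [:: c; b].
  by move=> b; apply: left_extendable.
have /choice[th1 th1P] : forall x : A, exists g, rauzy_walk 1 [:: a] [:: x] g.
  move=> x; have [w _ Lw] := Lrec.2 _ _ (letters a) (letters x).
  exists (fg_of_word (w ++ [:: x])); have := @rauzy_walk_word [:: a] _ Lw.
  by rewrite catA size_cat addn1 drop_size_cat.
pose th0 (x : A) := th1 (root share_right x).
pose th (x : A) := if connect share_right b0 x then th0 p * fg_gen b0 else th0 x.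
have th0_class (x y : A) : connect share_right x y -> th0 x = th0 y.
  by move=> xy; congr th1; apply/(rootP connect_share_sym).
have th_class (x y : A) : connect share_right x y -> th x = th y.
  move=> xy; rewrite /th (th0_class _ _ xy).
  by rewrite !(connect_share_sym b0) (same_connect connect_share_sym xy).
have th0P (x : A) : rauzy_walk 1 [:: a] [:: x] (th0 x).
  rewrite -[th0 x]mulg1; apply: walk_cat (th1P _) _; apply: rauzy_walk_connect.
  by rewrite connect_share_sym; apply: connect_root.
have edge (x c : A) : L [:: x; c] -> rauzy_edge 1 [:: x] (fg_gen c) [:: c].
  by move=> Lxc; exists c.
have thP (x : A) : rauzy_walk 1 [:: a] [:: x] (th x).
  rewrite /th; case: ifP => // b0x; rewrite -[_ * fg_gen b0]mulg1.
  apply: walk_cat (rauzy_walk_connect b0x).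
  exact: walk_forth (th0P p) (edge _ _ Lpb).
pose gam b := th (pred b) * fg_gen b * (th b)^-1.
have th_pred (x c : A) : L [:: x; c] -> th x = th (pred c).
  move=> Lxc; apply/th_class/connect1.
  exact: share_right_intro Lxc (predP c).
have gam0 : gam b0 = 1.
  rewrite /gam -(th_pred _ _ Lpb) {1}/th connect_share_sym (negbTE pb).
  by rewrite /th connect0 mulgV.
exists [seq gam b | b <- rem b0 (enum A)].
  rewrite size_map size_rem ?mem_enum // -cardE ltn_predL.
  by apply/card_gt0P; exists a.
have [G1 _ _] := generated_is_subgroup [set` [seq gam b | b <- rem b0 (enum A)]].
apply/seteqP; split.
  apply: (generated_min (walk_is_subgroup _ _)) => g /= /mapP[b _ ->].
  apply: walk_cat (walk_rev (thP b)).
  exact: walk_forth (thP _) (edge _ _ (predP b)).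
move=> g /= aa.
(* Telescoping yields a conjugate by [th a]. As [th a] is itself the label of a
   loop at [a], conjugating the loop beforehand compensates for this. *)
have -> : g = th a * ((th a)^-1 * g * th a) * (th a)^-1.
  by rewrite !mulgA mulgV mul1g mulgK.
pose thw x := if x is c :: _ then th c else 1.
have aP := thP a.
have {}aa : rauzy_walk 1 [:: a] [:: a] ((th a)^-1 * g * th a).
  by apply: walk_cat aP; apply: walk_cat aa; apply: walk_rev.
have := @walk_telescope _ _ _ _ thw (generated_is_subgroup _) _ _ _ _ aa; apply.
move=> x h y [c [sx Lxc -> ->]]; case: x sx Lxc => [|x []] //= _ Lxc.
rewrite (th_pred _ _ Lxc) -/(gam c).
have [->|cb0] := eqVneq c b0; first by rewrite gam0.
apply: subset_generated => /=; apply: map_f.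
by rewrite mem_rem_uniq ?enum_uniq // inE cb0 mem_enum.
Qed.

End Letters.

End Rauzy.

(** * The equivalence *)

(* In (2) the pair u = v = [::] is excluded: its return set is the set of all
   one-letter words, so that (2) would hold for every language L. *)
Theorem corollary1p2 (A : finType) (L : set (seq A))
    (A_nonempty : 0 < #|A|)
    (L_suffix_connected : suffix_connected L)
    (L_uniformly_recurrent : uniformly_recurrent L)
    (A_sub_L : forall a : A, L [:: a]) :
  let all_return_sets_generate :=
    forall u v : seq A, L (u ++ v) -> return_group L u v = setT in
  let some_return_set_full_rank :=
    exists u v : seq A,
      [/\ L (u ++ v), u ++ v != [::] & has_rank (return_group L u v) #|A|] in
  let empty_word_connected := ext_connected L 1 1 [::] in
  (all_return_sets_generate <-> some_return_set_full_rank) /\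
  (some_return_set_full_rank <-> empty_word_connected).
Proof.
move=> P1 P2 P3; have [Lrec Hunif] := L_uniformly_recurrent.
have [a0 _] := card_gt0P A_nonempty.
have P12 : P1 -> P2.
  move=> H; exists [::], [:: a0]; split=> //; first exact: A_sub_L.
  by rewrite H; [apply: freeGroup_rank|apply: A_sub_L].
have P23 : P2 -> P3.
  case=> u [v [Luv]]; case/lastP uvE : (u ++ v) => [|w a] // _ [_ rank_min].
  have suv : suffix [:: a] (u ++ v) by rewrite uvE -cats1 suffix_suffix.
  have Hj y : L y -> 0 < size y -> trivially_joined L y.
    rewrite lt0n size_eq0 => Ly y0.
    exact/suffix_connected_joined/L_suffix_connected.
  have RG g := @return_group_loops _ L Lrec u v [:: a] g Hunif Hj Luv suv.
  apply: connect_share_ext_connected => // b c; apply: contrapT => /negP bc.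
  have [|s s_lt sE] := @disconnected_loops_generated _ L Lrec A_sub_L a.
    by exists b, c.
  have /rank_min : generated [set` [seq g ^ (fg_of_word v)^-1 | g <- s]]
      = return_group L u v.
    by rewrite generated_map_conj sE; apply/seteqP; split=> g /RG.
  by rewrite size_map leqNgt s_lt.
have P31 : P3 -> P1.
  move=> H u v Luv; apply/seteqP; split=> // g _.
  have Hj w : L w -> 0 <= size w -> trivially_joined L w.
    move=> Lw _; apply: suffix_connected_joined => //.
    have [->|w0] := eqVneq w [::]; first exact: connected_suffix_connected.
    exact: L_suffix_connected.
  apply/(@return_group_loops _ L Lrec u v [::] g) => //; first exact: suffix0s.
  apply: (gen_subgroup_full (walk_is_subgroup _ _)) => a.
  by apply: walk_edge; exists a; split=> //; apply: A_sub_L.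
by split; split; auto.
Qed.
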